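(* Let $\Gamma$ be a finite simplicial graph which is connected, triangle-free, has at least two edges, and is not a star. The dimension of $Z(A_\Gamma)$ is at most $\sum_{v\in V_0}(2\delta(v)-3)$.
   Context: $V$ is the vertex set of $\Gamma$; $lk(v)$ is the set of neighbours of $v$, $st(v)=lk(v)\cup\{v\}$; $\Gamma$ is a star if $\Gamma=st(v)$ for some $v$; $\delta(v)$ is the valence of $v$ in $\Gamma$. $L_v=lk(v)$, $L_v^\perp=\bigcap_{u\in L_v}st(u)$ (set of vertices). Vertices with the same link are equivalent, with $[v]\le[w]$ if $lk(v)\subseteq lk(w)$; $V_0$ consists of one chosen vertex from each maximal equivalence class. $F\langle S\rangle$ is the free group on $S$. $A_\Gamma=\langle V \mid vw=wv \text{ if } v,w \text{ are adjacent}\rangle$. $\mathcal O(F)$ is the unreduced, unprojectivized Culler–Vogtmann outer space of a free group $F$: minimal, free, isometric $F$-actions on simplicial metric trees up to equivariant isometry. A point can be viewed as a marked metric graph $T/F$ (without valence-one or valence-two vertices); varying the edge lengths of a fixed marked graph over $(0,\infty)$ gives an open cube, and $\mathcal O(F)$ is a disjoint union of such open cubes. Products $C=\prod_{v\in V_0}C_v$ of open cubes are the open cubes of $\prod_{v\in V_0}\mathcal O(F\langle L_v\rangle)$; $C_1$ is a face of $\bar C_2$ (closure) if it is obtained by letting some edge lengths go to zero. $Y$ is the subspace of $(T_v)_{v\in V_0}\in\prod_{v\in V_0}\mathcal O(F\langle L_v\rangle)$ such that for each $w\in V_0$ the minimal $F\langle L_w^\perp\rangle$-invariant subtrees of $T_v$,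 for all $v\in L_w\cap V_0$, are equivariantly isometric to each other. The spine $Z(A_\Gamma)$ is the geometric realization of the poset of nonempty cells $Y\cap C$ ordered by the face relation ($Y\cap C_1\le Y\cap C_2$ if $C_1$ is a face of $\bar C_2$). *)

(* Defs.v *)
From HB Require Import structures.
From mathcomp Require Import all_boot all_order all_algebra.
From mathcomp Require Import all_classical all_reals.

Set Implicit Arguments.
Unset Strict Implicit.
Unset Printing Implicit Defensive.

Import Order.TTheory GRing.Theory Num.Theory.

(** * Finite simplicial graphs, given by a symmetric irreflexive adjacency
      relation on a finite type *)

Section Graphs.
Variables (V : finType) (adj : rel V).
Implicit Types v w : V.

Definition edges : {set {set V}} :=
  [set [set p.1; p.2] | p : V * V & adj p.1 p.2].

Definition connected_graph : Prop := forall v w, connect adj v w.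

Definition triangle_free : Prop :=
  forall u v w, adj u v -> adj v w -> ~~ adj u w.

Definition lk v : {set V} := [set w | adj v w].
Definition st v : {set V} := v |: lk v.
Definition is_star : Prop := exists v, st v = [set: V].
Definition valence v : nat := #|lk v|.

Definition link_perp v : {set V} := (\bigcap_(u in lk v) st u)%SET.

(* The class [v] = {w | lk w = lk v} is maximal for the order induced by
   inclusion of links. *)
Definition maximal_class v : Prop :=
  forall w, lk v \subset lk w -> lk w = lk v.

Definition max_transversal (V0 : {set V}) : Prop :=
  (forall v, v \in V0 -> maximal_class v) /\
  (forall v, maximal_class v -> exists! w, w \in V0 /\ lk w = lk v).

End Graphs.

(** * Free groups, as groups of reduced words *)

Section FreeGroup.
Variable V : finType.

(* (v, true) stands for v and (v, false) for its inverse. *)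
Definition letter := (V * bool)%type.
Definition linv (a : letter) : letter := (a.1, ~~ a.2).

Definition reduced : pred (seq letter) := sorted (fun a b => b != linv a).

Record free_group := FreeGroup { word :> seq letter; _ : reduced word }.

HB.instance Definition _ := [isSub for word].
HB.instance Definition _ := [Choice of free_group by <:].

Definition push (a : letter) (w : seq letter) : seq letter :=
  if w is b :: w' then if b == linv a then w' else a :: w else [:: a].

Definition wmul (w z : seq letter) : seq letter := foldr push z w.
Definition winv (w : seq letter) : seq letter := rev (map linv w).

Lemma linvK : involutive linv.
Proof. by case=> v b; rewrite /linv /= negbK. Qed.

Lemma linv_neq a : linv a != a.
Proof. by case: a => v []; rewrite /linv -pair_eqE /= /pair_eq /= eqxx. Qed.

Lemma push_reduced a w : reduced w -> reduced (push a w).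
Proof.
case: w => //= b w Hw; case: eqP => [_|/eqP Hb] /=; last by rewrite Hb.
exact: path_sorted Hw.
Qed.

Lemma wmul_reduced w z : reduced z -> reduced (wmul w z).
Proof. by move=> Hz; elim: w => //= a w IHw; apply: push_reduced. Qed.

Lemma push_linv a w : reduced w -> push a (push (linv a) w) = w.
Proof.
case: w => [|b w] /=; first by rewrite eqxx.
rewrite linvK; case: eqP => [->|_] /=; last by rewrite eqxx.
by case: w => //= c w /andP[/negbTE -> _].
Qed.

Lemma wmul_push a w z : reduced z -> wmul (push a w) z = push a (wmul w z).
Proof.
move=> Hz; case: w => //= b w; case: eqP => [->|_] //=.
by rewrite push_linv // wmul_reduced.
Qed.

Lemma wmulA w1 w2 w3 : reduced w3 ->
  wmul w1 (wmul w2 w3) = wmul (wmul w1 w2) w3.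
Proof. by move=> H3; elim: w1 => //= a w ->; rewrite wmul_push. Qed.

Lemma wmulw0 w : reduced w -> wmul w [::] = w.
Proof.
elim: w => //= a w IHw Hw; rewrite IHw; last exact: path_sorted Hw.
by case: w Hw {IHw} => //= b w /andP[/negbTE ->].
Qed.

Lemma winv_reduced w : reduced w -> reduced (winv w).
Proof.
rewrite /reduced /winv rev_sorted; case: w => //= a w.
elim: w a => //= b w IHw a /andP[Hb Hw].
by rewrite IHw // andbT linvK; apply: contra Hb => /eqP ->.
Qed.

Lemma wmul_winvl w z : reduced z -> wmul (winv w) (wmul w z) = z.
Proof.
rewrite /winv => Hz; elim: w => //= a w IHw.
rewrite rev_cons -cats1 /wmul foldr_cat /= -[in push a _](linvK a).
by rewrite push_linv // wmul_reduced.
Qed.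

Lemma winvK : involutive winv.
Proof.
by move=> w; rewrite /winv map_rev revK -map_comp map_id_in // => a _ /=;
  rewrite linvK.
Qed.

Definition fg_one : free_group := @FreeGroup [::] isT.
Definition fg_mul (g h : free_group) : free_group :=
  FreeGroup (wmul_reduced g (valP h)).
Definition fg_inv (g : free_group) : free_group :=
  FreeGroup (winv_reduced (valP g)).

Lemma fg_mulA : associative fg_mul.
Proof. by move=> g h k; apply: val_inj; rewrite /= wmulA // (valP k). Qed.
Lemma fg_mul1g : left_id fg_one fg_mul.
Proof. by move=> g; apply: val_inj. Qed.
Lemma fg_mulg1 : right_id fg_one fg_mul.
Proof. by move=> g; apply: val_inj; rewrite /= wmulw0 // (valP g). Qed.
Lemma fg_mulVg : left_inverse fg_one fg_inv fg_mul.
Proof.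
move=> g; apply: val_inj => /=.
by rewrite -{2}[val g](wmulw0 (valP g)) wmul_winvl.
Qed.
Lemma fg_mulgV : right_inverse fg_one fg_inv fg_mul.
Proof.
move=> g; apply: val_inj => /=; have := @wmul_winvl (winv (val g)) [::] isT.
by rewrite winvK wmulw0 // winv_reduced // (valP g).
Qed.

HB.instance Definition _ := isGroup.Build free_group
  fg_mulA fg_mul1g fg_mulg1 fg_mulVg fg_mulgV.

End FreeGroup.

Local Open Scope classical_set_scope.
Local Open Scope card_scope.
Local Open Scope ring_scope.

(* F<S>, as the subgroup of the free group on V that is free on S. *)
Definition free_sub (V : finType) (S : {set V}) : set (free_group V) :=
  [set g | all (fun a : letter V => a.1 \in S) g].

(** * Metric graphs and trees *)

(* Graphs in the sense of Serre: e and its reverse [flip e] are the two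
   orientations of one geometric edge. *)
Record metric_graph (R : realType) := MetricGraph {
  vert : Type;
  edge : Type;
  src : edge -> vert;
  flip : edge -> edge;
  len : edge -> R;
  flipK : involutive flip;
  flip_neq : forall e, flip e <> e;
  len_gt0 : forall e, 0 < len e;
  len_flip : forall e, len (flip e) = len e
}.
Arguments src {R} m e.
Arguments flip {R} m e.
Arguments len {R} m e.

Section MetricGraphs.
Variables (R : realType) (G : metric_graph R).
Implicit Types (x y : vert G) (e : edge G) (p : seq (edge G)).

Definition tgt e : vert G := src G (flip G e).

(* p is an edge path from x to y all of whose edges lie in E. *)
Fixpoint epath (E : set (edge G)) x p y : Prop :=
  if p is e :: p' then [/\ E e, src G e = x & epath E (tgt e) p' y] else x = y.

Fixpoint no_backtrack p : Prop :=
  if p is e :: p' then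
    (if p' is e' :: _ then e' <> flip G e else True) /\ no_backtrack p'
  else True.

Definition is_tree : Prop :=
  [/\ exists x : vert G, True,
      forall x y, exists p, epath setT x p y &
      forall x p, epath setT x p x -> no_backtrack p -> p = [::]].

(* The full subgraph spanned by a set A of vertices. *)
Definition inner_edges (A : set (vert G)) : set (edge G) :=
  [set e | A (src G e) /\ A (tgt e)].

(* In a tree, a subtree is the full subgraph spanned by its vertices, so we
   represent subtrees by their sets of vertices. *)
Definition subtree (A : set (vert G)) : Prop :=
  A !=set0 /\
  (forall x y, A x -> A y -> exists p, epath (inner_edges A) x p y).

(* Points of the geometric realization: [Pt_edge e t] is the point of e at
   distance t from [src G e]. The same point has several names; [dist] below
   is a pseudometric for which names of the same point are at distance 0. *)
Variant pt := Pt_vert of vert G | Pt_edge of edge G & R.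

Definition realization (A : set (vert G)) : set pt :=
  [set z | match z with
           | Pt_vert x => A x
           | Pt_edge e t => inner_edges A e /\ 0 <= t <= len G e
           end].

(* [leg z x a]: the vertex x is an end of the cell containing z, and a is the
   distance from z to x inside this cell. *)
Variant leg : pt -> vert G -> R -> Prop :=
| Leg_vert x : leg (Pt_vert x) x 0
| Leg_src e t : leg (Pt_edge e t) (src G e) t
| Leg_tgt e t : leg (Pt_edge e t) (tgt e) (len G e - t).

(* [route z z' r]: some path from z to z' has length r. *)
Variant route : pt -> pt -> R -> Prop :=
| Route_edge e s t : route (Pt_edge e s) (Pt_edge e t) `|s - t|
| Route_flip e s t :
    route (Pt_edge e s) (Pt_edge (flip G e) t) `|s - (len G e - t)|
| Route_path z z' x y a b p : leg z x a -> leg z' y b -> epath setT x p y ->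
    route z z' (a + \sum_(e <- p) len G e + b).

Definition dist (z z' : pt) : R := inf [set r | route z z' r].

End MetricGraphs.

(** * Unreduced, unprojectivized outer space of F<S> *)

(* A point of this type represents a point of O(F<S>); two representatives of
   the same point differ by an equivariant isometry. The values of [actv] and
   [acte] at elements outside F<S> are irrelevant. The simplicial structure is
   the one without vertices of valence one or two. *)
Record outer_space (R : realType) (V : finType) (S : {set V}) := OuterSpace {
  tree :> metric_graph R;
  actv : free_group V -> vert tree -> vert tree;
  acte : free_group V -> edge tree -> edge tree;
  treeP : is_tree tree;
  actv1 : forall x, actv 1%g x = x;
  acte1 : forall e, acte 1%g e = e;
  actvM : forall g h x, free_sub S g -> free_sub S h ->
    actv (g * h)%g x = actv g (actv h x);
  acteM : forall g h e, free_sub S g -> free_sub S h ->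
    acte (g * h)%g e = acte g (acte h e);
  act_src : forall g e, free_sub S g ->
    src tree (acte g e) = actv g (src tree e);
  act_flip : forall g e, free_sub S g ->
    acte g (flip tree e) = flip tree (acte g e);
  act_len : forall g e, free_sub S g -> len tree (acte g e) = len tree e;
  (* no nontrivial element fixes a vertex or the midpoint of an edge *)
  act_free : forall g, free_sub S g -> g <> 1%g ->
    (forall x, actv g x <> x) /\ (forall e, acte g e <> flip tree e);
  act_minimal : forall A : set (vert tree), subtree A ->
    (forall g x, free_sub S g -> A x -> A (actv g x)) -> A = setT;
  not_valence1 : forall x, ~ ([set e | src tree e = x] #= `I_1);
  not_valence2 : forall x, ~ ([set e | src tree e = x] #= `I_2)
}.
Arguments actv {R V S} o g x.
Arguments acte {R V S} o g e.

Section OuterSpace.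
Variables (R : realType) (V : finType).

Section Cubes.
Variable S : {set V}.
Implicit Types T : outer_space R S.

(* T/F<S> and T'/F<S> are the same marked graph, edge lengths disregarded. *)
Definition same_marked_graph T T' : Prop :=
  exists (fv : vert T -> vert T') (fe : edge T -> edge T'),
  [/\ bijective fv /\ bijective fe,
      forall e, src T' (fe e) = fv (src T e),
      forall e, fe (flip T e) = flip T' (fe e),
      forall g x, free_sub S g -> fv (actv T g x) = actv T' g (fv x) &
      forall g e, free_sub S g -> fe (acte T g e) = acte T' g (fe e)].

Definition cube_of T : set (outer_space R S) :=
  [set T' | same_marked_graph T T'].

Definition open_cube (C : set (outer_space R S)) : Prop :=
  exists T, C = cube_of T.

(* When the lengths of an invariant set of edges of T (those with
   [fe e = None]) tend to 0, the limit is T with these edges collapsed;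
   T' is isomorphic to this limit. *)
Definition collapses_to T T' : Prop :=
  exists (fv : vert T -> vert T') (fe : edge T -> option (edge T')),
  [/\ [/\ forall y, exists x, fv x = y,
          forall x y, fv x = fv y <->
            exists p, epath [set e | fe e = None] x p y &
          forall e', exists! e, fe e = Some e'],
      forall e e', fe e = Some e' -> src T' e' = fv (src T e),
      forall e, fe (flip T e) = omap (flip T') (fe e),
      forall g x, free_sub S g -> fv (actv T g x) = actv T' g (fv x) &
      forall g e, free_sub S g -> fe (acte T g e) = omap (acte T' g) (fe e)].

(* C1 is a face of the closure of C2 (possibly C2 itself). *)
Definition face (C1 C2 : set (outer_space R S)) : Prop :=
  exists T1 T2, [/\ C1 = cube_of T1, C2 = cube_of T2 & collapses_to T2 T1].

End Cubes.

Definition min_subtree (U S : {set V}) (T : outer_space R S) : set (vert T) :=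
  \bigcap_(A in [set A | subtree A /\
    (forall g x, free_sub U g -> A x -> A (actv T g x))]) A.
Arguments min_subtree U {S} T.

Definition act_point (S : {set V}) (T : outer_space R S) g (z : pt T) :
    pt T :=
  match z with
  | Pt_vert x => Pt_vert (actv T g x)
  | Pt_edge e t => Pt_edge (acte T g e) t
  end.

(* The minimal F<U>-invariant subtrees of T and T' are F<U>-equivariantly
   isometric. This is meant for U contained in both S and S'. *)
Definition min_subtrees_isometric (U S S' : {set V})
    (T : outer_space R S) (T' : outer_space R S') : Prop :=
  let X := realization (min_subtree U T) in
  let X' := realization (min_subtree U T') in
  exists f : pt T -> pt T',
  [/\ forall z, X z -> X' (f z),
      forall z1 z2, X z1 -> X z2 -> dist (f z1) (f z2) = dist z1 z2,
      forall z', X' z' -> exists2 z, X z & dist (f z) z' = 0 &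
      forall g z, free_sub U g -> X z ->
        dist (f (act_point g z)) (act_point g (f z)) = 0].

End OuterSpace.

(** * The complex Y and its cells *)

Section Spine.
Variables (R : realType) (V : finType) (adj : rel V) (V0 : {set V}).

Definition V0_type := {v : V | v \in V0}.

Definition outer_product : Type :=
  forall v : V0_type, outer_space R (lk adj (val v)).

Definition Y : set outer_product :=
  [set T | forall w u v : V0_type,
     val u \in lk adj (val w) -> val v \in lk adj (val w) ->
     min_subtrees_isometric (link_perp adj (val w)) (T u) (T v)].

Definition cube_product
    (C : forall v : V0_type, set (outer_space R (lk adj (val v)))) :
    set outer_product := [set T | forall v, C v (T v)].

Definition product_cube (C : set outer_product) : Prop :=
  exists2 Cv : forall v : V0_type, set (outer_space R (lk adj (val v))),
    (forall v, open_cube (Cv v)) & C = cube_product Cv.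

Definition product_face (C1 C2 : set outer_product) : Prop :=
  exists Cv1 Cv2 : forall v : V0_type, set (outer_space R (lk adj (val v))),
  [/\ C1 = cube_product Cv1, C2 = cube_product Cv2 &
      forall v, face (Cv1 v) (Cv2 v)].

Definition cell (D : set outer_product) : Prop :=
  D !=set0 /\ exists2 C, product_cube C & D = Y `&` C.

Definition cell_le (D1 D2 : set outer_product) : Prop :=
  exists C1 C2, [/\ product_cube C1 /\ product_cube C2,
    D1 = Y `&` C1, D2 = Y `&` C2 & product_face C1 C2].

End Spine.

(** * Geometric realizations of posets, as simplicial complexes *)

(* The simplices of the realization of the poset (P, le) are the nonempty
   finite chains; a complex is given by its simplices, as sets of vertices. *)
Definition order_complex (T : Type) (P : set T) (le : T -> T -> Prop) :
    set (set T) :=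
  [set s | [/\ finite_set s, s !=set0, s `<=` P &
               forall x y, s x -> s y -> le x y \/ le y x]].

(* A simplex with k+1 vertices has dimension k. *)
Definition dim_at_most (T : Type) (K : set (set T)) (n : int) : Prop :=
  forall s k, K s -> s #= `I_k.+1 -> k%:Z <= n.

(* The spine of the outer space of the right-angled Artin group of the graph. *)
Definition spine (R : realType) (V : finType) (adj : rel V) (V0 : {set V}) :
    set (set (set (outer_product R adj V0))) :=
  order_complex (@cell R V adj V0) (@cell_le R V adj V0).
Arguments spine : clear implicits.

(* Main.v *)
(* The number of vertices of the quotient graph T_v/F<L_v> depends only on the
   open cube of T_v. A collapse does not increase it, and preserves it only if
   no edge is collapsed; so the sum of these numbers over V0 is strictly
   monotone on chains of cells. Since these graphs have rank delta(v) and all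
   valences at least 3, they have between 1 and 2 delta(v) - 2 vertices, so the
   sum takes at most 1 + \sum_v (2 delta(v) - 3) values. *)
Require Import Defs.
From HB Require Import structures.
From mathcomp Require Import all_boot all_order all_algebra.
From mathcomp Require Import all_classical all_reals.
From mathcomp Require Import zify.
Local Open Scope ring_scope.

Set Implicit Arguments.
Unset Strict Implicit.
Unset Printing Implicit Defensive.

Import Order.TTheory GRing.Theory Num.Theory.
Local Open Scope classical_set_scope.
Local Open Scope card_scope.

(** * Subgroups generated by sets of letters *)

Section FreeSubgroups.
Variables (V : finType) (S : {set V}).
Implicit Types (a : letter V) (g h : free_group V).

Definition gen a : free_group V := @FreeGroup V [:: a] isT.

Lemma gen_linv a : gen (linv a) = (gen a)^-1%g.
Proof. exact: val_inj. Qed.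

Lemma free_sub_gen a : a.1 \in S -> free_sub S (gen a).
Proof. by rewrite /free_sub /= andbT. Qed.

Lemma free_subV g : free_sub S g -> free_sub S g^-1%g.
Proof.
rewrite /free_sub /= /winv all_rev all_map => /allP gS.
by apply/allP => a /gS.
Qed.

Lemma free_subM g h : free_sub S g -> free_sub S h -> free_sub S (g * h)%g.
Proof.
rewrite /free_sub /= => gS hS; elim: (word g) gS => //= a w IHw /andP[aS wS].
rewrite /push; case: (wmul w h) (IHw wS) => [|b z] /=; first by rewrite aS.
by move=> /andP[bS zS]; case: ifP => // _; rewrite /= aS bS zS.
Qed.

(** Induction on the reduced word: its tail is reduced, and multiplying the first letter back causes
    no cancellation. *)
Lemma free_sub_ind (P : free_group V -> Prop) :
  P 1%g ->
  (forall a g, a.1 \in S -> free_sub S g -> P g -> P (gen a * g)%g) ->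
  forall g, free_sub S g -> P g.
Proof.
move=> P1 PM [w wr]; rewrite /free_sub /=; elim: w wr => [|a w IHw] wr /=.
  by rewrite (_ : FreeGroup wr = 1%g) //; apply: val_inj.
move=> /andP[aS wS]; have wr' : reduced w by apply: path_sorted wr.
have -> : FreeGroup wr = (gen a * FreeGroup wr')%g;
  last by apply: PM => //; apply: IHw.
apply: val_inj; rewrite /= /push; case: w wr {IHw wS wr'} => //= b w.
by case/andP => /negbTE ->.
Qed.

End FreeSubgroups.

(** * Edge paths and mod 2 cochains on trees *)

Section Paths.
Variables (R : realType) (G : metric_graph R).
Implicit Types (x y z : vert G) (e : edge G) (p q : seq (edge G)).

Lemma tgt_flip e : tgt (flip G e) = src G e.
Proof. by rewrite /tgt flipK. Qed.

Lemma epath_cat E x p q z :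
  epath E x (p ++ q) z <-> exists2 y, epath E x p y & epath E y q z.
Proof.
elim: p x => [|e p IHp] x /=; first by split=> [|[y -> //]]; exists x.
split=> [[Ee ex /IHp[y py qz]]|[y [Ee ex py] qz]]; first by exists y.
by split=> //; apply/IHp; exists y.
Qed.

Lemma epath_sub (E E' : set (edge G)) x p y :
  E `<=` E' -> epath E x p y -> epath E' x p y.
Proof.
by move=> EE'; elim: p x => //= e p IHp x [/EE' ? ? /IHp].
Qed.

Lemma epath_rev (E : set (edge G)) x p y :
  (forall e, E e -> E (flip G e)) ->
  epath E x p y -> epath E y (rev (map (flip G) p)) x.
Proof.
move=> Ef; elim: p x => [|e p IHp] x /=; first by move->.
move=> [Ee <- /IHp pP]; rewrite rev_cons -cats1.
apply/epath_cat; exists (tgt e) => //.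
by split; rewrite ?tgt_flip //; apply: Ef.
Qed.

Definition psum (c : edge G -> bool) p : bool :=
  foldr (fun e b => c e (+) b) false p.

Lemma psum_cat c p q : psum c (p ++ q) = psum c p (+) psum c q.
Proof. by elim: p => //= e p ->; rewrite addbA. Qed.

Lemma psum_rev c p : (forall e, c (flip G e) = c e) ->
  psum c (rev (map (flip G) p)) = psum c p.
Proof.
move=> cf; elim: p => //= e p IHp.
by rewrite rev_cons -cats1 psum_cat IHp /= cf addbF addbC.
Qed.

Lemma backtrackP p : no_backtrack p \/
  exists p1 e p2, p = p1 ++ e :: flip G e :: p2.
Proof.
elim: p => [|e p [IHp|[p1 [f [p2 ->]]]]] /=; first by left.
  case: p IHp => [|f p] IHp; first by left.
  have [->|] := pselect (f = flip G e); first by right; exists [::], e, p.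
  by left.
by right; exists (e :: p1), f, p2.
Qed.

Hypothesis treeG : is_tree G.

(** Deleting a backtrack removes two equal values, which cancel mod 2; a closed path of a tree
    without backtracks is empty. *)
Lemma psum_closed c x p : (forall e, c (flip G e) = c e) ->
  epath setT x p x -> psum c p = false.
Proof.
move=> cf; have [n] := ubnP (size p); elim: n p => // n IHn p ltn pP.
have [nb|[p1 [e [p2 Ep]]]] := backtrackP p.
  by case: treeG => _ _ /(_ _ _ pP nb) ->.
subst p; rewrite psum_cat /= cf addKb -psum_cat IHn //.
  by move: ltn; rewrite !size_cat /= !addnS => /ltnW.
move/epath_cat: pP => [y p1y /= [_ ey [_ _ p2x]]].
by apply/epath_cat; exists y => //; rewrite -ey -tgt_flip.
Qed.

(* Trees are simply connected, so mod 2 cochains are coboundaries. *)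
Lemma potential c x0 : (forall e, c (flip G e) = c e) ->
  exists b : vert G -> bool,
    b x0 = false /\ forall e, c e = b (src G e) (+) b (tgt e).
Proof.
move=> cf; case: treeG => _ conn _.
have [p pP] := choice (conn x0); exists (fun x => psum c (p x)); split.
  exact: psum_closed cf (pP x0).
move=> e; have Ef (f : edge G) : setT f -> setT (flip G f) by [].
(* The closed path runs from [x0] to the source of [e], across [e], and back from its target. *)
have : psum c (p (src G e) ++ e :: rev (map (flip G) (p (tgt e)))) = false.
  apply: (@psum_closed c x0) => //; apply/epath_cat; exists (src G e) => //=.
  by split=> //; apply: epath_rev.
by rewrite psum_cat /= psum_rev //; case: (c e); case: psum; case: psum.
Qed.

Lemma potential_const (c : vert G -> bool) :
  (forall e, c (src G e) = c (tgt e)) -> forall x y, c x = c y.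
Proof.
move=> ce x y; case: treeG => _ /(_ x y)[p pP] _.
by elim: p x pP => [|e p IHp] x /= => [->//|[_ <- /IHp <-]].
Qed.

Lemma tree_no_loop e : tgt e <> src G e.
Proof.
move=> ex; case: treeG => _ _ /(_ (src G e) [:: e]).
by move=> H; have // : [:: e] = [::]; apply: H.
Qed.

End Paths.

(** * Orbits of vertices *)

Section Orbits.
Variables (R : realType) (V : finType) (S : {set V}) (T : outer_space R S).
Implicit Types (g h : free_group V) (x y z : vert T) (e : edge T).
Implicit Types (p q : seq (edge T)).

Lemma actvK g x : free_sub S g -> actv T g^-1%g (actv T g x) = x.
Proof.
by move=> gS; rewrite -actvM ?mulVg ?actv1 //; apply: free_subV.
Qed.

Lemma actvVK g x : free_sub S g -> actv T g (actv T g^-1%g x) = x.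
Proof.
by move=> gS; rewrite -actvM ?mulgV ?actv1 //; apply: free_subV.
Qed.

Lemma acteK g e : free_sub S g -> acte T g^-1%g (acte T g e) = e.
Proof.
by move=> gS; rewrite -acteM ?mulVg ?acte1 //; apply: free_subV.
Qed.

Lemma act_tgt g e : free_sub S g -> tgt (acte T g e) = actv T g (tgt e).
Proof. by move=> gS; rewrite /tgt -act_flip // act_src. Qed.

Lemma actv_fix g x : free_sub S g -> actv T g x = x -> g = 1%g.
Proof.
move=> gS gx; have [//|g1] := pselect (g = 1%g).
by have [/(_ x)] := act_free T gS g1.
Qed.

Lemma epath_act (E : set (edge T)) g x p y :
  free_sub S g -> (forall e, E e -> E (acte T g e)) ->
  epath E x p y -> epath E (actv T g x) (map (acte T g) p) (actv T g y).
Proof.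
move=> gS Eg; elim: p x => [|e p IHp] x /=; first by move->.
move=> [Ee <- /IHp pP]; split; [exact: Eg|exact: act_src|].
by rewrite act_tgt.
Qed.

(** As [i] is unrestricted, the default [z0] belongs to the set too; this is harmless when [z0 = x],
    as in the use below. *)
Lemma epath_support z0 x p y : epath setT x p y ->
  epath (inner_edges
    [set z | z = x \/ exists i, z = nth z0 (map (@tgt _ T) p) i]) x p y.
Proof.
elim: p x => //= e p IHp x [_ ex /IHp pP]; split=> //.
  by split; [left|right; exists 0%N].
apply: epath_sub pP => f [fs ft]; split; right.
  by case: fs => [->|[i ->]]; [exists 0%N|exists i.+1].
by case: ft => [->|[i ->]]; [exists 0%N|exists i.+1].
Qed.

Lemma epath_prefix (E : set (edge T)) z0 x p y i :
  epath E x p y -> (i < size p)%N ->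
  exists q, epath E x q (nth z0 (map (@tgt _ T) p) i).
Proof.
elim: p x i => //= e p IHp x [|i] [Ee ex pP] lti.
  by exists [:: e].
by have [q qP] := IHp _ i pP lti; exists (e :: q).
Qed.

Definition vcovers m (r : 'I_m -> vert T) : Prop :=
  forall x, exists i g, free_sub S g /\ x = actv T g (r i).

(* The translates of finitely many paths joining a base vertex to its images
   under the generators form an invariant subtree, which is everything. *)
Lemma finite_cover : exists m (r : 'I_m -> vert T), vcovers r.
Proof.
have [[x0 _] conn _] := treeP T.
have [p pP] := choice (fun a => conn x0 (actv T (gen a) x0)).
pose pv a := nth x0 (map (@tgt _ T) (p a)).
pose B := [set y | y = x0 \/ exists a i, y = pv a i].
pose A := [set x | exists g y, [/\ free_sub S g, B y & x = actv T g y]].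
have BA y : B y -> A y by exists 1%g, y; rewrite actv1.
have Ainv g x : free_sub S g -> A x -> A (actv T g x).
  move=> gS [h [y [hS By ->]]]; exists (g * h)%g, y; split=> //.
    exact: free_subM.
  by rewrite actvM.
pose E := inner_edges A.
have Einv g e : free_sub S g -> E e -> E (acte T g e).
  by move=> gS [es et]; split; rewrite ?act_src ?act_tgt //; apply: Ainv.
have Eflip e : E e -> E (flip T e).
  by move=> [es et]; split=> //; rewrite tgt_flip.
have pE a : epath E x0 (p a) (actv T (gen a) x0).
  apply: epath_sub (epath_support x0 (pP a)) => e [es et].
  split; apply: BA.
    by case: es => [->|[i ->]]; [left|right; exists a, i].
  by case: et => [->|[i ->]]; [left|right; exists a, i].
(* For a word with first letter [a], follow [p a], then the translate by [gen a] of the path for the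
   remaining word. *)
have base g : free_sub S g -> exists q, epath E x0 q (actv T g x0).
  elim/free_sub_ind: g / => [|a g aS gS [q qP]].
    by exists [::]; rewrite actv1.
  have aS' := free_sub_gen aS.
  exists (p a ++ map (acte T (gen a)) q); apply/epath_cat.
  exists (actv T (gen a) x0) => //; rewrite actvM //.
  by apply: epath_act => // e; apply: Einv.
have reach x : A x -> exists q, epath E x0 q x.
  move=> [g [y [gS By ->]]]; have [q qP] := base g gS.
  have [q' q'P] : exists q', epath E x0 q' y.
    case: By => [->|[a [i ->]]]; first by exists [::].
    have [lti|lei] := ltnP i (size (p a)); first exact: epath_prefix (pE a) lti.
    by exists [::]; rewrite /pv nth_default // size_map.
  exists (q ++ map (acte T g) q'); apply/epath_cat.
  exists (actv T g x0) => //.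
  by apply: epath_act => // e; apply: Einv.
have AT : A = setT.
  apply: (act_minimal (o := T)) => //; split.
    by exists x0; apply: BA; left.
  move=> x y /reach[q qP] /reach[q' q'P].
  exists (rev (map (flip T) q) ++ q'); apply/epath_cat; exists x0 => //.
  exact: epath_rev.
(* Beyond index [N] every [pv a] takes its default value [x0], so finitely many indices suffice. *)
pose N := (\max_(a : letter V) size (p a))%N.
pose I : finType := option (letter V * 'I_N.+1)%type.
pose r (k : I) := if k is Some (a, i) then pv a i else x0.
exists #|I|, (fun i => r (enum_val i)) => x.
have [g [y [gS By ->]]] : A x by rewrite AT.
suff [k ->] : exists k, y = r k by exists (enum_rank k), g; rewrite enum_rankK.
case: By => [->|[a [i ->]]]; first by exists None.
have [lti|lei] := ltnP i N.+1; first by exists (Some (a, Ordinal lti)).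
exists None; rewrite /pv nth_default // size_map.
by apply: leq_trans (ltnW lei); rewrite (leq_bigmax a).
Qed.

Lemma norb_subproof :
  exists m, `[< exists r : 'I_m -> vert T, vcovers r >].
Proof. by have [m Hm] := finite_cover; exists m; apply/asboolP. Qed.

(* The number of vertices of the quotient graph T/F<S>. *)
Definition norb : nat := ex_minn norb_subproof.

Lemma norb_le m (r : 'I_m -> vert T) : vcovers r -> (norb <= m)%N.
Proof.
by rewrite /norb; case: ex_minnP => n _ + rP; apply; apply/asboolP; exists r.
Qed.

Lemma norb_reps : exists r : 'I_norb -> vert T, vcovers r.
Proof. by rewrite /norb; case: ex_minnP => n /asboolP. Qed.

Lemma norb_gt0 : (0 < norb)%N.
Proof.
have [[x _] _ _] := treeP T; have [r /(_ x)[i _]] := norb_reps.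
exact: leq_ltn_trans (ltn_ord i).
Qed.

(** If two representatives shared an orbit, dropping one would leave a cover smaller than the
    minimum. *)
Lemma vcovers_inj m (r : 'I_m -> vert T) : vcovers r -> m = norb ->
  forall i j g, free_sub S g -> r j = actv T g (r i) -> i = j.
Proof.
case: m r => [|m] r rP mE i j g gS rij; first by case: i rij.
have [//|/eqP ij] := pselect (i = j).
suff : (norb <= m)%N by rewrite -mE ltnn.
apply: (@norb_le _ (fun k => r (lift j k))) => x.
have [k [h [hS ->]]] := rP x.
have [k' ->|->] := unliftP j k; first by exists k', h.
case: (unliftP j i) ij => [i' Ei _|->]; last by rewrite eqxx.
exists i', (h * g)%g; split; first exact: free_subM.
by rewrite rij -Ei actvM.
Qed.

End Orbits.

(** * Behaviour of the orbit count under collapses *)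

Section Collapses.
Variables (R : realType) (V : finType) (S : {set V}).
Implicit Types T : outer_space R S.

Lemma vcovers_image T T' (fv : vert T -> vert T') m (r : 'I_m -> vert T) :
  (forall y, exists x, fv x = y) ->
  (forall g x, free_sub S g -> fv (actv T g x) = actv T' g (fv x)) ->
  vcovers r -> vcovers (fun i => fv (r i)).
Proof.
move=> fsurj fact rP y; have [x <-] := fsurj y.
have [i [g [gS ->]]] := rP x.
by exists i, g; rewrite fact.
Qed.

Lemma inj_surj_bij (A B : Type) (f : A -> B) :
  (forall x y, f x = f y -> x = y) -> (forall y, exists x, f x = y) ->
  bijective f.
Proof.
move=> finj /choice[g gP]; exists g => // x.
exact/finj/gP.
Qed.

Lemma same_marked_graph_sym T T' :
  same_marked_graph T T' -> same_marked_graph T' T.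
Proof.
move=> [fv [fe [[[gv fvK gvK] [ge feK geK]] fs ff fav fae]]].
exists gv, ge; split; first by split; [exists fv|exists fe].
- by move=> e; apply: (can_inj fvK); rewrite -fs geK gvK.
- by move=> e; apply: (can_inj feK); rewrite ff !geK.
- by move=> g x gS; apply: (can_inj fvK); rewrite fav // !gvK.
- by move=> g x gS; apply: (can_inj feK); rewrite fae // !geK.
Qed.

Lemma same_marked_graph_trans T T' T'' : same_marked_graph T T' ->
  same_marked_graph T' T'' -> same_marked_graph T T''.
Proof.
move=> [fv [fe [[bfv bfe] fs ff fav fae]]] [hv [he [[bhv bhe] hs hf hav hae]]].
exists (hv \o fv), (he \o fe); split=> [|e|e|g x gS|g e gS] /=.
- by split; apply: bij_comp.
- by rewrite hs fs.
- by rewrite ff hf.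
- by rewrite fav ?hav.
- by rewrite fae ?hae.
Qed.

Lemma cube_of_eq T T' : same_marked_graph T T' -> cube_of T = cube_of T'.
Proof.
move=> TT'; apply/seteqP; split=> T'' /=.
  by apply: same_marked_graph_trans; apply: same_marked_graph_sym.
exact: same_marked_graph_trans.
Qed.

Lemma same_marked_graph_norb T T' : same_marked_graph T T' -> norb T = norb T'.
Proof.
have le T1 T2 : same_marked_graph T1 T2 -> (norb T2 <= norb T1)%N.
  move=> [fv [fe [[[gv fvK gvK] _] _ _ fact _]]]; have [r rP] := norb_reps T1.
  by apply: norb_le (vcovers_image _ fact rP) => y; exists (gv y).
by move=> TT'; apply/eqP; rewrite eqn_leq !le //; apply: same_marked_graph_sym.
Qed.

Lemma collapse_norb_le T T' : collapses_to T T' -> (norb T' <= norb T)%N.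
Proof.
move=> [fv [fe [[fsurj _ _] _ _ fact _]]]; have [r rP] := norb_reps T.
exact: norb_le (vcovers_image fsurj fact rP).
Qed.

(* If the collapse identifies no vertex orbits, then the ends of a collapsed
   edge are x and g x with the same image, so g = 1 by freeness and the edge
   is a loop; hence no edge is collapsed. *)
Lemma collapse_norb_eq T T' : collapses_to T T' -> norb T' = norb T ->
  same_marked_graph T T'.
Proof.
move=> [fv [fe [[fsurj fvE fe_uniq] fs ff fav fae]]] nE.
have [r rP] := norb_reps T.
have r'P := vcovers_image fsurj fav rP.
(* The images of the representatives form a cover of [T'] of minimal size, so they lie in distinct
   orbits. *)
have orbit_inj x y : fv x = fv y -> exists2 g, free_sub S g & y = actv T g x.
  have [i [g [gS ->]]] := rP x; have [j [h [hS ->]]] := rP y.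
  rewrite !fav // => E.
  have ij : i = j.
    apply: (vcovers_inj r'P (esym nE) (g := (h^-1 * g)%g)).
      by apply: free_subM => //; apply: free_subV.
    by rewrite actvM ?E ?actvK //; apply: free_subV.
  exists (h * g^-1)%g; first by apply: free_subM => //; apply: free_subV.
  by rewrite ij actvM ?actvK //; apply: free_subV.
have fe_some e : exists e', fe e = Some e'.
  case E : (fe e) => [e'|]; first by exists e'.
  have pP : fv (src T e) = fv (tgt e).
    by apply/fvE; exists [:: e].
  have [g gS tE] := orbit_inj _ _ pP.
  have g1 : g = 1%g.
    apply: (actv_fix (T := T') gS (x := fv (src T e))).
    by rewrite -fav // -tE.
  by case: (@tree_no_loop _ T (treeP T) e); rewrite tE g1 actv1.
have [fe' fe'P] := choice fe_some.
exists fv, fe'; split=> [|e|e|g x gS|g e gS].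
- split; [apply: inj_surj_bij => [x y|//]|apply: inj_surj_bij => [e1 e2 E|e']].
  (* Vertices with the same image are joined by a path of collapsed edges, which is now empty. *)
  + by move=> /fvE[[|e p] //=]; rewrite fe'P => -[].
  + have [e [_ eU]] := fe_uniq (fe' e1).
    by rewrite -(eU e1) // -(eU e2) // E.
  + have [e [eP _]] := fe_uniq e'; exists e.
    by apply: Some_inj; rewrite -fe'P.
- exact/fs/fe'P.
- by apply: Some_inj; rewrite -fe'P ff fe'P.
- exact: fav.
- by apply: Some_inj; rewrite -fe'P fae // fe'P.
Qed.

End Collapses.

(** * Bounding the orbit count by the rank *)

Section Bound.
Variables (R : realType) (V : finType) (S : {set V}) (T : outer_space R S).
Hypothesis S_gt0 : (0 < #|S|)%N.

(** A generator moves [x], so a path from [x] to its image has a first edge. *)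
Lemma edge_at x : exists e, src T e = x.
Proof.
have [s sS] := card_gt0P S_gt0.
have gS : free_sub S (gen (s, true)) by apply: free_sub_gen.
have [_ conn _] := treeP T.
have [[|e p] /=] := conn x (actv T (gen (s, true)) x);
  last by case=> _; exists e.
by move=> /esym /(actv_fix gS) /(congr1 val).
Qed.

Lemma three_edges x :
  exists f : 'I_3 -> edge T, injective f /\ forall i, src T (f i) = x.
Proof.
have [e0 e0x] := edge_at x.
have [e1 [e1x e10]] : exists e1, src T e1 = x /\ e1 <> e0.
  apply: contrapT => H; apply: (@not_valence1 _ _ _ T x).
  apply/eq_cardSP; exists e0 => //; rewrite II0.
  rewrite card_eq0; apply/eqP/seteqP; split=> // e [/= ex e0e].
  by apply: H; exists e.
have [e2 [e2x e20 e21]] : exists e2, [/\ src T e2 = x, e2 <> e0 & e2 <> e1].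
  apply: contrapT => H; apply: (@not_valence2 _ _ _ T x).
  apply/eq_cardSP; exists e0 => //; apply/eq_cardSP; exists e1 => //.
  rewrite II0 card_eq0; apply/eqP/seteqP; split=> // e [[/= ex e0e] e1e].
  by apply: H; exists e.
exists (fun i : 'I_3 => nth e0 [:: e0; e1; e2] i); split.
  move=> [[|[|[|//]]] i3] [[|[|[|//]]] j3] //= E; try exact: val_inj;
    by move: E; try move/esym.
by case=> [[|[|[|//]]]].
Qed.

(* Mod 2 Euler characteristic count. An invariant cochain on edges has a
   potential vanishing at the first representative, and is determined by the
   values of this potential at the images of that vertex under the generators
   and at the other m representatives. So T/F<S> has at most |S| + m unoriented
   edges, while its m + 1 vertices have valence at least 3. *)
Lemma cover_bound m (r : 'I_m.+1 -> vert T) : vcovers r ->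
  (forall i j g, free_sub S g -> r j = actv T g (r i) -> i = j) ->
  (m + 3 <= 2 * #|S|)%N.
Proof.
move=> rP rinj.
have [E0 E0P] := choice (fun i => three_edges (r i)).
pose J : finType := ('I_m.+1 * 'I_3)%type.
pose E (j : J) := E0 j.1 j.2.
(* The chosen oriented edges lie in distinct orbits: their sources do unless equal, and vertex
   stabilizers are trivial. *)
have Einj g j j' : free_sub S g -> acte T g (E j) = E j' -> j = j'.
  move=> gS EE; have := congr1 (src T) EE; rewrite act_src //.
  case: j j' EE => [i a] [i' a']; rewrite /E /= => EE.
  have [E1 E2] := E0P i; have [_ E2'] := E0P i'; rewrite E2 E2' => gr.
  have ii := rinj _ _ _ gS (esym gr); subst i'; congr pair; apply: E1.
  by move: EE; rewrite (actv_fix gS gr) acte1.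
(* The classes of [eqv] are the unoriented edges of the quotient graph. *)
pose eqv e e' :=
  exists g, free_sub S g /\ (acte T g e = e' \/ acte T g e = flip T e').
have eqv_refl e : eqv e e by exists 1%g; rewrite acte1; split; [|left].
have eqv_sym e e' : eqv e e' -> eqv e' e.
  move=> [g [gS H]]; exists g^-1%g; split; first exact: free_subV.
  case: H => [<-|H]; [left|right]; first by rewrite acteK.
  by rewrite -[e'](flipK (m := T)) -H act_flip ?acteK //; apply: free_subV.
have eqv_trans e e' e'' : eqv e e' -> eqv e' e'' -> eqv e e''.
  move=> [g [gS H]] [h [hS H']]; exists (h * g)%g.
  split; first exact: free_subM.
  rewrite acteM //; case: H => ->; case: H' => H';
    rewrite ?act_flip // H' ?flipK; by [left|right].
have eqv_flip e : eqv e (flip T e).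
  by exists 1%g; rewrite acte1 flipK; split; [|right].
have eqv_act g e : free_sub S g -> eqv e (acte T g e).
  by move=> gS; exists g; split; [|left].
pose ER (j j' : J) := `[< eqv (E j) (E j') >].
have ERP : {in [set: J]%SET & &, equivalence_rel ER}.
  move=> j1 j2 j3 _ _ _; split; first exact/asboolP.
  move=> /asboolP H; apply: asbool_equiv_eq; split; last exact: eqv_trans.
  exact/eqv_trans/eqv_sym.
pose P := equivalence_partition ER [set: J]%SET.
have Ppart : finset.partition P [set: J]%SET :=
  finset.equivalence_partitionP ERP.
have Ptriv := finset.partition_trivIset Ppart.
have pblockE j j' : (j' \in finset.pblock P j) = ER j j'.
  exact: (finset.pblock_equivalence_partition ERP).
have Prep B : B \in P -> exists2 j, j \in B & finset.pblock P j = B.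
  move=> BP; have [j jB] := finset.set0Pn _ (finset.partition_neq0 Ppart BP).
  by exists j => //; apply: finset.def_pblock.
(* An unoriented edge has two orientations: [f] tells which one [j'] represents, and is injective on
   [B] by [Einj]. *)
have cardB B : B \in P -> (#|B| <= 2)%N.
  move=> BP; have [j jB jE] := Prep B BP.
  pose f j' := `[< exists g, free_sub S g /\ acte T g (E j) = E j' >].
  have fflip j' : j' \in B -> f j' = false ->
      exists g, free_sub S g /\ acte T g (E j) = flip T (E j').
    rewrite -jE pblockE => /asboolP[g [gS [H|H]]]; last by exists g.
    by move=> /asboolPn; case; exists g.
  have finj : {in B &, injective f}.
    move=> j1 j2 j1B j2B; case f1: (f j1) => /esym f2.
      move/asboolP: f1 => [g [gS gE]]; move/asboolP: f2 => [h [hS hE]].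
      apply: (@Einj (h * g^-1)%g); first by apply/free_subM/free_subV.
      by rewrite -gE acteM ?acteK //; apply: free_subV.
    have [g [gS gE]] := fflip _ j1B f1; have [h [hS hE]] := fflip _ j2B f2.
    apply: (@Einj (h * g^-1)%g); first by apply/free_subM/free_subV.
    apply: (can_inj (flipK (m := T))); rewrite -act_flip; last first.
      by apply/free_subM/free_subV.
    by rewrite -gE acteM ?acteK //; apply: free_subV.
  by rewrite -(card_in_imset finj) (leq_trans (max_card _)) // card_bool.
have cardP : (3 * m.+1 <= 2 * #|P|)%N.
  have := card_partition Ppart; rewrite cardsT card_prod !card_ord mulnC => ->.
  by rewrite mulnC -sum_nat_const; apply: leq_sum.
(* The invariant cochain supported on the edge classes in [Q]. *)
pose c (Q : {set {set J}}) e :=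
  `[< exists j, finset.pblock P j \in Q /\ eqv (E j) e >].
have c_eqv Q e e' : eqv e e' -> c Q e = c Q e'.
  move=> ee'; apply: asbool_equiv_eq; split=> -[j [jQ je]];
    exists j; split=> //.
    exact: eqv_trans ee'.
  exact: eqv_trans je (eqv_sym _ _ ee').
have cE Q j : c Q (E j) = (finset.pblock P j \in Q).
  apply/asboolP/idP => [[j' [j'Q H]]|jQ]; last by exists j.
  rewrite (finset.same_pblock Ptriv (y := j')) // pblockE.
  exact/asboolP.
pose x0 := r ord0.
have [b bP] := choice (fun Q =>
  potential (treeP T) x0 (fun e => esym (c_eqv Q _ _ (eqv_flip e)))).
pose F Q := ([set s in S | b Q (actv T (gen (s, true)) x0)]%SET,
             [set i : 'I_m | b Q (r (lift ord0 i))]%SET).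
have Finj : {in powerset P &, injective F}.
  move=> Q Q'; rewrite !inE => QP Q'P [/setP FS /setP Fr].
  have [b0 bc] := bP Q; have [b0' bc'] := bP Q'.
  pose d x := b Q x (+) b Q' x.
  have d0 : d x0 = false by rewrite /d b0 b0'.
  (* The coboundary of [d] is invariant, so [d (g y) + d y] does not depend on [y]; its value at
     [x0] is [d (g x0)]. *)
  have dact g x : free_sub S g -> d (actv T g x) = d x (+) d (actv T g x0).
    move=> gS.
    have := @potential_const _ _ (treeP T) (fun y => d (actv T g y) (+) d y).
    move=> /(_ _ x x0); rewrite d0 addbF => <-; first by rewrite addbC addbK.
    move=> e; have := c_eqv Q _ _ (eqv_act g e gS).
    have := c_eqv Q' _ _ (eqv_act g e gS).
    rewrite !bc !bc' act_src // act_tgt // /d.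
    by do 8![case: (b _ _)].
  have dS s x : s \in S -> d (actv T (gen (s, true)) x) = d x.
    move=> sS; rewrite dact; last exact: free_sub_gen.
    by have := FS s; rewrite !inE sS /= /d => ->; rewrite addbb addbF.
  have dinv g x : free_sub S g -> d (actv T g x) = d x.
    move=> gS; elim/free_sub_ind: g / gS x => [|[s []] g /= sS gS IHg] x.
    - by rewrite actv1.
    - by rewrite actvM ?dS ?IHg //; apply: free_sub_gen.
    - rewrite actvM //; last exact: free_sub_gen.
      have -> : gen (s, false) = (gen (s, true))^-1%g.
        exact: (gen_linv (s, true)).
      by rewrite -(dS s) // actvVK ?IHg //; apply: free_sub_gen.
  (* Now [d] is invariant and vanishes at all representatives, hence everywhere. *)
  have dr i : d (r i) = false.
    have [i' ->|->//] := unliftP ord0 i.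
    by have := Fr i'; rewrite !inE /d => ->; rewrite addbb.
  have cc e : c Q e = c Q' e.
    have bb x : b Q x = b Q' x.
      have [i [g [gS ->]]] := rP x.
      by move: (dr i); rewrite -(dinv g) // /d; do 2!case: (b _ _).
    by rewrite bc bc' !bb.
  apply/setP => B; have [BP|BP] := boolP (B \in P).
    by have [j _ jB] := Prep B BP; rewrite -jB -!cE cc.
  by rewrite (contraNF (fintype.subsetP QP B)) //
    (contraNF (fintype.subsetP Q'P B)).
have cardF : (2 ^ #|P| <= 2 ^ (#|S| + m))%N.
  rewrite -card_powerset -(card_in_imset Finj) expnD -card_powerset.
  rewrite -[m in X in (_ <= X)%N]card_ord -cardsT -card_powerset -cardsX.
  apply/subset_leq_card/fintype.subsetP => _ /imsetP[Q _ ->].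
  rewrite !inE /= finset.subsetT andbT.
  by apply/fintype.subsetP => s; rewrite inE => /andP[].
(* Combine [#|P| <= #|S| + m] with [3 * (m + 1) <= 2 * #|P|]. *)
by move: cardF cardP; rewrite leq_exp2l //; lia.
Qed.

Lemma norb_bound : (norb T + 2 <= 2 * #|S|)%N.
Proof.
have [r rP] := norb_reps T; have rinj := vcovers_inj rP erefl.
case: (norb T) (norb_gt0 T) r rP rinj => // m _ r rP rinj.
by have := cover_bound rP rinj; rewrite addSn !addnS.
Qed.

End Bound.

(** * Heights and their monotonicity along faces *)

Lemma link_gt0 (V : finType) (adj : rel V) v :
  connected_graph adj -> ~ is_star adj -> (0 < #|lk adj v|)%N.
Proof.
move=> conn; rewrite lt0n; apply: contra_notN => /eqP/card0_eq lk0.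
exists v; apply/setP => w; rewrite !inE.
case/connectP: (conn v w) => [[|u p] /= + ->]; first by rewrite eqxx.
by case/andP=> vu; have := lk0 u; rewrite inE vu.
Qed.

Section Heights.
Variables (R : realType) (V : finType) (adj : rel V) (V0 : {set V}).
Implicit Types (T : outer_product R adj V0) (D : set (outer_product R adj V0)).

Definition height T : nat := (\sum_(v : {v : V | v \in V0}) norb (T v))%N.

Lemma height_ge T : (#|V0| <= height T)%N.
Proof.
have := @leq_sum {v : V | v \in V0} (index_enum _) xpredT (fun=> 1%N)
  (fun v => norb (T v)) (fun v _ => norb_gt0 (T v)).
by rewrite sum1_card card_sig.
Qed.

Lemma height_le T : (forall v, v \in V0 -> (0 < #|lk adj v|)%N) ->
  (height T + 2 * #|V0| <= 2 * \sum_(v in V0) valence adj v)%N.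
Proof.
move=> lk_gt0; rewrite (big_sub (fun v => v \in V0)) /=.
have -> : #|V0| = #|{: {v : V | v \in V0}}| by rewrite card_sig.
rewrite mulnC -sum_nat_const -big_split /= big_distrr /=.
by apply: leq_sum => v _; apply/norb_bound/lk_gt0/(valP v).
Qed.

(** Since [norb] is constant on open cubes, the factors of [T1] and [T2] may be replaced by trees
    related by a collapse. *)
Lemma cell_le_mono D1 D2 T1 T2 : cell_le D1 D2 -> D1 T1 -> D2 T2 ->
  (height T1 <= height T2)%N /\ (height T1 = height T2 -> D1 = D2).
Proof.
move=> [_ [_ [_ -> -> [C1 [C2 [-> -> C12]]]]]] [_ T1C] [_ T2C].
have ntP v : (norb (T1 v) <= norb (T2 v))%N /\
    (norb (T1 v) = norb (T2 v) -> C1 v = C2 v).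
  have [U1 [U2 [E1 E2 U21]]] := C12 v.
  have := T1C v; rewrite E1 => /same_marked_graph_norb <-.
  have := T2C v; rewrite E2 => /same_marked_graph_norb <-.
  split; first exact: collapse_norb_le.
  by move=> /(collapse_norb_eq U21)/cube_of_eq.
have nt_le v := (ntP v).1; split; first by apply: leq_sum => v _.
move=> hE; suff -> : C1 = C2 by [].
apply: functional_extensionality_dep => v; apply: (ntP v).2.
(* Termwise inequalities between equal sums are equalities. *)
have := leqif_sum (fun v (_ : xpredT v) => leqif_eq (nt_le v)).
rewrite /height in hE; rewrite hE => -[_ /esym].
by rewrite eqxx => /forallP/(_ v)/eqP.
Qed.

End Heights.

(** * Counting the cells of a chain *)

Theorem proposition7p16 (R : realType) (V : finType) (adj : rel V)
    (adj_sym : symmetric adj) (adj_irr : irreflexive adj)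
    (conn : connected_graph adj) (tri_free : triangle_free adj)
    (two_edges : (2 <= #|edges adj|)%N) (not_star : ~ is_star adj)
    (V0 : {set V}) (V0P : max_transversal adj V0) :
  dim_at_most (spine R V adj V0)
    (\sum_(v in V0) (2 * (valence adj v)%:Z - 3)).
Proof.
move=> s k [_ _ s_cell s_tot] sk.
have /choice[h hP] (D : set (outer_product R adj V0)) :
    exists n, cell D -> exists2 T, D T & n = height T.
  have [[[T DT] _]|nc] := pselect (cell D); last by exists 0%N.
  by exists (height T); exists T.
have h_inj : {in s &, injective h}.
  move=> D1 D2; rewrite !inE => sD1 sD2.
  have [T1 DT1 ->] := hP _ (s_cell _ sD1).
  have [T2 DT2 ->] := hP _ (s_cell _ sD2) => hE.
  have [le12|le21] := s_tot _ _ sD1 sD2.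
    exact: (cell_le_mono le12 DT1 DT2).2.
  exact/esym/(cell_le_mono le21 DT2 DT1).2.
pose N := (2 * \sum_(v in V0) valence adj v)%N.
have h_bound D : s D -> (#|V0| <= h D)%N /\ (h D + 2 * #|V0| <= N)%N.
  move=> /s_cell/hP[T _ ->]; split; first exact: height_ge.
  by apply: height_le => v _; apply: link_gt0.
(* Heights on [s] range from [#|V0|] to [N - 2 * #|V0|]; [f] shifts this interval to start at 0. *)
have kN : (k.+1 <= (N - 3 * #|V0|).+1)%N.
  pose f D := (h D - #|V0|)%N.
  have f_inj : {in s &, injective f}.
    move=> D1 D2 sD1 sD2 fE; apply: h_inj => //.
    have := sD1; rewrite inE => /h_bound[le1 _].
    by have := sD2; rewrite inE => /h_bound[le2 _]; rewrite /f in fE; lia.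
  rewrite -card_le_II -(card_le_eql sk) -(card_le_eql (inj_card_eq f_inj)).
  apply: subset_card_le => _ [D /h_bound[le1 le2] <-] /=; rewrite /f; lia.
(* A member of the chain shows [3 * #|V0| <= N], so the subtraction in [kN] is not truncated. *)
have [D sD] : exists D, s D.
  by have /eq_cardSP[D sD _] := sk; exists D.
have [le1 le2] := h_bound D sD.
have -> : \sum_(v in V0) (2 * (valence adj v)%:Z - 3) = N%:Z - (3 * #|V0|)%:Z.
  rewrite sumrB -mulr_sumr sumr_const -(big_morph Posz PoszD (erefl _)) /N; lia.
lia.
Qed.
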